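(* Let $M$ be a complex matrix of size $n$, let $E$ be the exchange matrix of size $n$, and let $C$ be a (nonsingular) centrosymmetric matrix of size $n$. (a) $C$ diagonalizes $EM$ and $ME$ if and only if $C$ antidiagonalizes $M$. The diagonalization and antidiagonalization are both unitary if and only if $C$ is unitary. (b) $C$ diagonalizes $M$ if and only if $C$ antidiagonalizes $EM$ and $ME$. The diagonalization and antidiagonalization are both unitary if and only if $C$ is unitary.
   Context: The exchange matrix $E$ is the antidiagonal matrix of size $n$ whose antidiagonal entries are all $1$. A matrix is antidiagonal if its only nonzero entries are at positions $(i,n+1-i)$. A matrix $C$ is centrosymmetric if it is symmetric about its center: $C_{i,j}=C_{n+1-i,\,n+1-j}$. ''$C$ diagonalizes (antidiagonalizes) $X$'' means $X=CYC^{-1}$ with $Y$ diagonal (antidiagonal); this diagonalization (antidiagonalization) is unitary if the similarity matrix $C$ is unitary. *)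

(* Defs.v *)
From mathcomp Require Export all_boot all_order all_algebra.
From mathcomp Require Export spectral reals complex.

Set Implicit Arguments.
Unset Strict Implicit.
Unset Printing Implicit Defensive.

Import GRing.Theory Num.Theory.
Local Open Scope ring_scope.

(* With 0-based indices, the antidiagonal positions (i, n + 1 - i) are the    *)
(* pairs (i, rev_ord i).                                                      *)
Definition is_antidiag_mx (R : pzRingType) (n : nat) (A : 'M[R]_n) : Prop :=
  forall i j : 'I_n, j != rev_ord i -> A i j = 0.

Definition exchange_mx (R : pzRingType) (n : nat) : 'M[R]_n :=
  \matrix_(i, j) (j == rev_ord i)%:R.

Definition centrosymmetric (R : pzRingType) (n : nat) (C : 'M[R]_n) : Prop :=
  forall i j : 'I_n, C i j = C (rev_ord i) (rev_ord j).

(* The convention is X = C Y C^-1, whereas MathComp's conjmx and diagonalizable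
   (mxred) use C X C^-1 = Y.  Since invmx C = C for singular C, invertibility
   is required explicitly. *)
Definition diagonalizes (F : fieldType) (n : nat) (C X : 'M[F]_n) : Prop :=
  C \in unitmx /\
  exists Y : 'M[F]_n, is_diag_mx Y /\ X = C *m Y *m invmx C.

Definition antidiagonalizes (F : fieldType) (n : nat) (C X : 'M[F]_n) : Prop :=
  C \in unitmx /\
  exists Y : 'M[F]_n, is_antidiag_mx Y /\ X = C *m Y *m invmx C.

Definition unitarily_diagonalizes (K : numClosedFieldType) (n : nat)
    (C X : 'M[K]_n) : Prop :=
  diagonalizes C X /\ C \is unitarymx.

Definition unitarily_antidiagonalizes (K : numClosedFieldType) (n : nat)
    (C X : 'M[K]_n) : Prop :=
  antidiagonalizes C X /\ C \is unitarymx.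

(* Main.v *)
(* A centrosymmetric C commutes with the involution E, so multiplying
   M = C Y C^-1 by E on either side replaces Y by E Y or Y E; this exchanges
   diagonal and antidiagonal matrices.  Part (b) is part (a) applied to E M
   and to M E. *)
Require Import Defs.
From mathcomp Require Import all_boot all_order all_algebra.
From mathcomp Require Import spectral reals complex.

Set Implicit Arguments.
Unset Strict Implicit.
Unset Printing Implicit Defensive.

Local Open Scope ring_scope.

Lemma mul_exchange_mxE (R : pzRingType) (n : nat) (A : 'M[R]_n) (i j : 'I_n) :
  (exchange_mx R n *m A) i j = A (rev_ord i) j.
Proof.
rewrite mxE (bigD1 (rev_ord i)) //= big1 => [|k /negPf ki].
  by rewrite mxE eqxx GRing.mul1r GRing.addr0.
by rewrite mxE ki GRing.mul0r.
Qed.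

Lemma mulmx_exchangeE (R : pzRingType) (n : nat) (A : 'M[R]_n) (i j : 'I_n) :
  (A *m exchange_mx R n) i j = A i (rev_ord j).
Proof.
rewrite mxE (bigD1 (rev_ord j)) //= big1 => [|k kj].
  by rewrite mxE rev_ordK eqxx GRing.mulr1 GRing.addr0.
(* The entry of the exchange matrix at [(k, j)] tests [j == rev_ord k]; reversing both sides turns
   this into [rev_ord j == k], which [kj] refutes. *)
by rewrite mxE -(inj_eq rev_ord_inj) rev_ordK eq_sym (negPf kj) GRing.mulr0.
Qed.

Lemma exchange_mxK (R : pzRingType) (n : nat) :
  exchange_mx R n *m exchange_mx R n = 1%:M.
Proof.
by apply/matrixP => i j; rewrite mul_exchange_mxE !mxE rev_ordK eq_sym.
Qed.

(** The two products have entries [C i (rev_ord j)] and [C (rev_ord i) j], which are mirror images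
    through the center. *)
Lemma centrosymmetric_comm_exchange (R : pzRingType) (n : nat) (C : 'M[R]_n) :
  centrosymmetric C -> comm_mx C (exchange_mx R n).
Proof.
move=> csC; apply/matrixP => i j.
by rewrite mul_exchange_mxE mulmx_exchangeE csC rev_ordK.
Qed.

(** Left multiplication by the exchange matrix reverses the rows, which carries the antidiagonal
    onto the diagonal; on the right it reverses the columns, to the same effect. *)
Lemma diag_exchange_mull (R : pzRingType) (n : nat) (Y : 'M[R]_n) :
  is_diag_mx (exchange_mx R n *m Y) <-> is_antidiag_mx Y.
Proof.
split=> [/is_diag_mxP dY i j ji | aY].
  by rewrite -(rev_ordK i) -mul_exchange_mxE dY // eq_sym.
apply/is_diag_mxP => i j ij.
by rewrite mul_exchange_mxE aY // rev_ordK eq_sym.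
Qed.

Lemma diag_exchange_mulr (R : pzRingType) (n : nat) (Y : 'M[R]_n) :
  is_diag_mx (Y *m exchange_mx R n) <-> is_antidiag_mx Y.
Proof.
split=> [/is_diag_mxP dY i j ji | aY].
  rewrite -(rev_ordK j) -mulmx_exchangeE dY //.
  by apply: contraNneq ji => /val_inj ->; rewrite rev_ordK.
apply/is_diag_mxP => i j ij.
by rewrite mulmx_exchangeE aY // (inj_eq rev_ord_inj) eq_sym.
Qed.

Lemma diagonalizes_exchange_mull (F : fieldType) (n : nat) (C M : 'M[F]_n) :
  centrosymmetric C ->
  diagonalizes C (exchange_mx F n *m M) <-> antidiagonalizes C M.
Proof.
set E := exchange_mx F n => /centrosymmetric_comm_exchange CE.
(* Since [E] is an involution commuting with [C], the same witness serves both directions: [E]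
   passes through [C] and lands on [Y]. *)
split=> -[uC [Y [Yd defM]]]; split=> //; exists (E *m Y); split.
- by apply/diag_exchange_mull; rewrite mulmxA exchange_mxK mul1mx.
- by rewrite mulmxA CE -!mulmxA [C *m _]mulmxA -defM mulmxA exchange_mxK mul1mx.
- exact/diag_exchange_mull.
- by rewrite defM !mulmxA CE.
Qed.

Lemma diagonalizes_exchange_mulr (F : fieldType) (n : nat) (C M : 'M[F]_n) :
  centrosymmetric C ->
  diagonalizes C (M *m exchange_mx F n) <-> antidiagonalizes C M.
Proof.
set E := exchange_mx F n => /centrosymmetric_comm_exchange CE.
split=> -[uC [Y [Yd defM]]]; split=> //; exists (Y *m E); split;
  (* A factor [E] on the right meets [invmx C] before [Y], so commutation is needed for the inverse:
     multiply [CE] by [invmx C] on both sides. *)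
  have CVE : E *m invmx C = invmx C *m E
    by rewrite -[LHS](mulKmx uC) !mulmxA -[_ *m C *m E]mulmxA CE mulmxA mulmxK.
- by apply/diag_exchange_mulr; rewrite -mulmxA exchange_mxK mulmx1.
- by rewrite mulmxA -mulmxA CVE mulmxA -defM -mulmxA exchange_mxK mulmx1.
- exact/diag_exchange_mulr.
- by rewrite defM !mulmxA -!mulmxA CVE.
Qed.

Theorem theorem5p20 (R : realType) (n : nat) (M C : 'M[R[i]]_n)
    (C_unit : C \in unitmx) (C_csym : centrosymmetric C) :
  let E : 'M[R[i]]_n := exchange_mx R[i] n in
  (* (a) *)
  ((diagonalizes C (E *m M) /\ diagonalizes C (M *m E)
      <-> antidiagonalizes C M)
   /\ (antidiagonalizes C M ->
       ((unitarily_diagonalizes C (E *m M)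
         /\ unitarily_diagonalizes C (M *m E)
         /\ unitarily_antidiagonalizes C M)
        <-> C \is unitarymx)))
  /\
  (* (b) *)
  ((diagonalizes C M
      <-> antidiagonalizes C (E *m M) /\ antidiagonalizes C (M *m E))
   /\ (diagonalizes C M ->
       ((unitarily_diagonalizes C M
         /\ unitarily_antidiagonalizes C (E *m M)
         /\ unitarily_antidiagonalizes C (M *m E))
        <-> C \is unitarymx))).
Proof.
move=> E.
have EK : E *m E = 1%:M := exchange_mxK _ _.
have dl X := diagonalizes_exchange_mull X C_csym.
have dr X := diagonalizes_exchange_mulr X C_csym.
(* Multiplying [E *m M] by [E] again gives back [M]. *)
have bl : diagonalizes C M <-> antidiagonalizes C (E *m M).
  by have := dl (E *m M); rewrite mulmxA EK mul1mx.
have br : diagonalizes C M <-> antidiagonalizes C (M *m E).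
  by have := dr (M *m E); rewrite -mulmxA EK mulmx1.
have := dl M; have := dr M.
rewrite /unitarily_diagonalizes /unitarily_antidiagonalizes -/E.
(* The rest is propositional: all unitary variants share the conjunct [C \is unitarymx], and the
   equivalences supply the other conjuncts. *)
tauto.
Qed.
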